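(* Let $A$ and $B$ be nontrivial groups with the unique root property, and suppose at least one of them has finite quotients of arbitrarily large prime order. Then the abstract commensurator $\mathrm{Comm}(A\ast B)$ of the free product $A\ast B$ is not finitely generated.
   Context: A group has the unique root property if for all $x,y$ in it and every positive integer $n$, $x^n=y^n$ implies $x=y$. The abstract commensurator $\mathrm{Comm}(G)$ of a group $G$ is the group of equivalence classes of isomorphisms between finite-index subgroups of $G$, two such isomorphisms being equivalent if they agree on some finite-index subgroup of $G$ on which both are defined; the product of $\alpha:G_1\to G_1'$ and $\beta:G_2\to G_2'$ is $\alpha\beta:\alpha^{-1}(G_1'\cap G_2)\to\beta(G_1'\cap G_2)$. *)

(* Defs.v *)
From Stdlib Require Import List.
From mathcomp Require Import all_boot all_fingroup.
Set Implicit Arguments.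
Unset Strict Implicit.
Unset Printing Implicit Defensive.

Record AGroup := {
  carrier :> Type;
  gmul : carrier -> carrier -> carrier;
  gone : carrier;
  ginv : carrier -> carrier;
  gmulA : forall x y z, gmul x (gmul y z) = gmul (gmul x y) z;
  gmul1 : forall x, gmul gone x = x;
  gmulV : forall x, gmul (ginv x) x = gone
}.

Fixpoint gpow (G : AGroup) (x : G) (n : nat) : G :=
  match n with
  | O => gone G
  | S k => gmul x (gpow x k)
  end.

Definition nontrivial (G : AGroup) : Prop := exists x : G, x <> gone G.

Definition unique_root (G : AGroup) : Prop :=
  forall (x y : G) (n : nat), (0 < n)%N -> gpow x n = gpow y n -> x = y.

Definition is_hom (G H : AGroup) (f : G -> H) : Prop :=
  forall x y : G, f (gmul x y) = gmul (f x) (f y).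

Definition is_free_product (A B G : AGroup) (iA : A -> G) (iB : B -> G) : Prop :=
  is_hom iA /\ is_hom iB /\
  forall (H : AGroup) (fA : A -> H) (fB : B -> H), is_hom fA -> is_hom fB ->
    (exists f : G -> H, is_hom f /\ (forall a, f (iA a) = fA a)
                                 /\ (forall b, f (iB b) = fB b)) /\
    (forall f g : G -> H, is_hom f -> is_hom g ->
       (forall a, f (iA a) = g (iA a)) -> (forall b, f (iB b) = g (iB b)) ->
       forall x, f x = g x).

Definition has_quotient_of_order (A : AGroup) (p : nat) : Prop :=
  exists (Q : finGroupType) (f : A -> Q),
    #|Q| = p /\
    (forall x y : A, f (gmul x y) = (f x * f y)%g) /\
    (forall q : Q, exists x, f x = q).

Definition arb_large_prime_quotients (A : AGroup) : Prop :=
  forall n : nat, exists p : nat, prime p /\ (n < p)%N /\ has_quotient_of_order A p.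

Definition subgroup (G : AGroup) (H : G -> Prop) : Prop :=
  H (gone G) /\ (forall x y, H x -> H y -> H (gmul x y)) /\
  (forall x, H x -> H (ginv x)).

Definition finite_index (G : AGroup) (H : G -> Prop) : Prop :=
  subgroup H /\
  exists reps : list G, forall x : G,
    exists g, In g reps /\ H (gmul (ginv g) x).

Record pmap (G : AGroup) := PMap {
  pdom : G -> Prop;
  pcod : G -> Prop;
  pfun : G -> G
}.

Definition is_comm (G : AGroup) (c : pmap G) : Prop :=
  finite_index (pdom c) /\ finite_index (pcod c) /\
  (forall x, pdom c x -> pcod c (pfun c x)) /\
  (forall x y, pdom c x -> pdom c y ->
     pfun c (gmul x y) = gmul (pfun c x) (pfun c y)) /\
  (forall x y, pdom c x -> pdom c y -> pfun c x = pfun c y -> x = y) /\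
  (forall y, pcod c y -> exists x, pdom c x /\ pfun c x = y).

Definition comm_equiv (G : AGroup) (c d : pmap G) : Prop :=
  exists L : G -> Prop, finite_index L /\
    (forall x, L x -> pdom c x /\ pdom d x /\ pfun c x = pfun d x).

Definition comm_id (G : AGroup) : pmap G :=
  PMap (fun _ : G => True) (fun _ : G => True) (fun x => x).

(* product alpha beta : alpha^{-1}(G1' cap G2) -> beta(G1' cap G2), x |-> beta(alpha x) *)
Definition comm_comp (G : AGroup) (a b : pmap G) : pmap G :=
  PMap (fun x => pdom a x /\ pcod a (pfun a x) /\ pdom b (pfun a x))
       (fun y => exists z, pcod a z /\ pdom b z /\ pfun b z = y)
       (fun x => pfun b (pfun a x)).

Definition comm_inverse_of (G : AGroup) (c d : pmap G) : Prop :=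
  (forall x, pdom d x <-> pcod c x) /\ (forall x, pcod d x <-> pdom c x) /\
  (forall x, pdom c x -> pfun d (pfun c x) = x).

(* representatives of elements of the subgroup of Comm(G) generated by S *)
Inductive comm_gen (G : AGroup) (S : list (pmap G)) : pmap G -> Prop :=
  | cg_id : comm_gen S (comm_id G)
  | cg_gen : forall s, In s S -> comm_gen S s
  | cg_inv : forall s d, In s S -> comm_inverse_of s d -> comm_gen S d
  | cg_comp : forall a b, comm_gen S a -> comm_gen S b -> comm_gen S (comm_comp a b).

Definition comm_fin_gen (G : AGroup) : Prop :=
  exists S : list (pmap G), (forall s, In s S -> is_comm s) /\
    forall c, is_comm c -> exists d, comm_gen S d /\ comm_equiv c d.

(* Main.v *)
From Stdlib Require Import List.
From mathcomp Require Import all_boot all_fingroup cyclic zify boolp.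
Require Import Defs.
(** Fix finitely many commensurations and a prime p exceeding all the indices of their domains and
    ranges.  For every d in the group they generate and every y, some y^k with k prime to p lies in
    the domain of d.  Let A -> Q be a quotient of order p, t in A with nontrivial image, b <> 1 in B,
    and let H be the kernel of the induced map A * B -> Q that kills B.  Then H is the free product
    of A /\ H and the conjugates of B by 1, t, ..., t^(p-1); conjugating only the factor B by t^p is
    an automorphism c of H, which maps (tb)^p to a conjugate of
      h = t^(1-p) b (tb)^(p-2) t^(p+1) b.
    If c were equivalent to some d as above then, with u = d((tb)^k), we would have
    u^(pN) = h^(kN) for some N > 0 and k prime to p.  But t^(p+1) occurs exactly once in the
    cyclically reduced word h, and counting its occurrences in cyclic normal forms gives p | k. *)
Set Implicit Arguments.
Unset Strict Implicit.
Unset Printing Implicit Defensive.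

Declare Scope agroup_scope.
Local Open Scope agroup_scope.
Local Notation "x ∙ y" := (gmul x y) (at level 40, left associativity) : agroup_scope.

(** * Elementary group theory, and powers lying in finite-index subgroups *)

Section AGroupTheory.
Variable G : AGroup.
Implicit Types x y z : G.

Lemma gmulKV x y : ginv x ∙ (x ∙ y) = y.
Proof. by rewrite gmulA gmulV gmul1. Qed.

Lemma gmulI x y z : x ∙ y = x ∙ z -> y = z.
Proof. by move=> e; rewrite -(gmulKV x y) e gmulKV. Qed.

Lemma gmul1r x : x ∙ gone G = x.
Proof. by apply: (@gmulI (ginv x)); rewrite gmulKV gmulV. Qed.

Lemma gmulVr x : x ∙ ginv x = gone G.
Proof. by apply: (@gmulI (ginv x)); rewrite gmulKV gmul1r. Qed.

Lemma gmulK x y : x ∙ (ginv x ∙ y) = y.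
Proof. by rewrite gmulA gmulVr gmul1. Qed.

Lemma ginv_unique x y : x ∙ y = gone G -> y = ginv x.
Proof. by move=> e; apply: (@gmulI x); rewrite e gmulVr. Qed.

Lemma ginvK x : ginv (ginv x) = x.
Proof. by rewrite -(ginv_unique (gmulV x)). Qed.

Lemma ginvM x y : ginv (x ∙ y) = ginv y ∙ ginv x.
Proof. by rewrite -(@ginv_unique (x ∙ y) (ginv y ∙ ginv x)) // -gmulA gmulK gmulVr. Qed.

Lemma ginv1 : ginv (gone G) = gone G.
Proof. by rewrite -(@ginv_unique (gone G) (gone G)) // gmul1. Qed.

Lemma ginv_eq1 x : ginv x = gone G -> x = gone G.
Proof. by move=> e; rewrite -(ginvK x) e ginv1. Qed.

Lemma gidem x : x ∙ x = x -> x = gone G.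
Proof. by move=> e; apply: (@gmulI x); rewrite e gmul1r. Qed.

Lemma gpowD x m n : gpow x (m + n) = gpow x m ∙ gpow x n.
Proof. by elim: m => [|m IH] /=; rewrite ?gmul1 // IH gmulA. Qed.

Lemma gpowM x m n : gpow x (m * n) = gpow (gpow x m) n.
Proof. by elim: n => [|n IH] /=; rewrite ?muln0 // mulnS gpowD IH. Qed.

Lemma gpow1n n : gpow (gone G) n = gone G.
Proof. by elim: n => //= n ->; rewrite gmul1. Qed.

Lemma gpow_conj x y n : gpow (x ∙ y ∙ ginv x) n = x ∙ gpow y n ∙ ginv x.
Proof.
elim: n => [|n IH] /=; first by rewrite gmul1r gmulVr.
by rewrite IH -!gmulA gmulKV.
Qed.

Lemma torsion_free : unique_root G ->
  forall x n, 0 < n -> gpow x n = gone G -> x = gone G.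
Proof. by move=> ur x n n0 e; apply: (ur _ _ n n0); rewrite gpow1n. Qed.

(** Pigeonhole on the cosets of 1, y, ..., y^m, where m is the number of representatives. The bound
    is uniform in y, so a prime above it divides none of the exponents k. *)
Lemma finite_index_pow (H : G -> Prop) : finite_index H ->
  exists m, forall y, exists k, [/\ 0 < k, k <= m & H (gpow y k)].
Proof.
move=> [[H1 [HM HV]] [reps hreps]]; exists (size reps) => y.
have /choice [r hr] : forall i : 'I_(size reps).+1, exists j : 'I_(size reps),
    forall x0, H (ginv (nth x0 reps j) ∙ gpow y i).
  move=> i; have [g [gin Hg]] := hreps (gpow y i).
  have [n [nlt gE]] := In_nth reps g (gone G) gin.
  have nlt' : n < size reps by apply/ltP.
  (* [In_nth] speaks of the Stdlib [nth]; the closing induction identifies it with that of mathcomp.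
     The index is in range, so the default is immaterial. *)
  exists (Ordinal nlt') => x0 /=; suff -> : nth x0 reps n = g by [].
  rewrite (set_nth_default (gone G)) // -gE.
  by elim: (reps) (n) => [|z s IH] [|k] //=.
have ninj : ~ injective r.
  by move=> /leq_card; rewrite !card_ord ltnn.
have [i [j [ij rij]]] : exists i j : 'I_(size reps).+1, i < j /\ r i = r j.
  apply: contrapT => h; apply: ninj => i j rij; apply: val_inj => /=.
  by case: (ltngtP i j) => // lt; case: h; [exists i, j | exists j, i].
exists (j - i); split; [by rewrite subn_gt0| by have := ltn_ord j; lia |].
have Hi := hr i (gone G); have := hr j (gone G); rewrite -rij.
rewrite -(subnKC (ltnW ij)) gpowD => /(HM _ _ (HV _ Hi)).
by rewrite ginvM ginvK -!gmulA gmulK gmulKV addKn.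
Qed.

End AGroupTheory.

(** * Homomorphisms, subgroups, and generation of a free product by its factors *)

Section Hom.
Variables (G K : AGroup) (f : G -> K).
Hypothesis fM : is_hom f.

Lemma hom1 : f (gone G) = gone K.
Proof. by apply: gidem; rewrite -fM gmul1. Qed.

Lemma homV x : f (ginv x) = ginv (f x).
Proof. by apply: ginv_unique; rewrite -fM gmulVr hom1. Qed.

Lemma homX x n : f (gpow x n) = gpow (f x) n.
Proof. by elim: n => [|n IH] /=; rewrite ?hom1 // fM IH. Qed.

End Hom.

Section SubGroup.
Variables (G : AGroup) (P : G -> Prop).
Hypothesis sP : subgroup P.

Definition sub_mul (x y : {x | P x}) : {x | P x} :=
  exist P (sval x ∙ sval y) (sP.2.1 _ _ (svalP x) (svalP y)).
Definition sub_inv (x : {x | P x}) : {x | P x} :=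
  exist P (ginv (sval x)) (sP.2.2 _ (svalP x)).

Lemma sval_inj (x y : {x | P x}) : sval x = sval y -> x = y.
Proof. by case: x y => [x Px] [y Py] /= e; apply: eq_exist. Qed.

Definition sub_agroup : AGroup.
Proof.
apply: (@Build_AGroup {x | P x} sub_mul (exist P (gone G) sP.1) sub_inv);
  move=> *; apply: sval_inj => /=; [exact: gmulA | exact: gmul1 | exact: gmulV].
Defined.

End SubGroup.

(** The universal property maps G into the subgroup P; followed by the inclusion this agrees with
    the identity on both factors, hence everywhere. *)
Lemma free_product_ind (A B G : AGroup) (iA : A -> G) (iB : B -> G) :
  is_free_product iA iB ->
  forall P : G -> Prop, subgroup P -> (forall a, P (iA a)) -> (forall b, P (iB b)) ->
  forall x, P x.
Proof.
move=> [hA [hB up]] P sP PA PB x.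
pose fA a : sub_agroup sP := exist P (iA a) (PA a).
pose fB b : sub_agroup sP := exist P (iB b) (PB b).
have fAM : is_hom fA by move=> a a'; apply: sval_inj; apply: hA.
have fBM : is_hom fB by move=> a a'; apply: sval_inj; apply: hB.
have [[f [fM [fiA fiB]]] _] := up _ fA fB fAM fBM.
have [_ uniq] := up G iA iB hA hB.
suff <- : sval (f x) = x by apply: svalP.
apply: (uniq (fun y => sval (f y)) id) => //.
- by move=> y z; rewrite fM.
- by move=> a; rewrite fiA.
- by move=> b; rewrite fiB.
Qed.

(** * Target groups for the universal property: permutations and wreath products *)

Section Permutations.
Variable X : Type.

Record permutation := Permutation {
  pm : X -> X;
  pm_inv : X -> X;
  pmK : cancel pm pm_inv;
  pm_invK : cancel pm_inv pm
}.

Lemma permutation_ext (s r : permutation) : pm s =1 pm r -> s = r.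
Proof.
case: s r => [s s' s1 s2] [r r' r1 r2] /= e.
have {}e : s = r by apply/funext.
rewrite {}e in s1 s2 *.
have e' : s' = r' by apply/funext => l; rewrite -{1}(r2 l) s1.
rewrite {}e' in s1 s2 *; congr Permutation; exact: Prop_irrelevance.
Qed.

Definition perm_one := @Permutation id id (fun x => erefl) (fun x => erefl).
Definition perm_mul (s r : permutation) :=
  Permutation (can_comp (pmK s) (pmK r)) (can_comp (pm_invK r) (pm_invK s)).
Definition perm_inv (s : permutation) := Permutation (pm_invK s) (pmK s).

Definition perm_agroup : AGroup.
Proof.
apply: (@Build_AGroup permutation perm_mul perm_one perm_inv) => *;
  apply: permutation_ext => l //=; exact: pmK.
Defined.

End Permutations.

Definition wreath_agroup (Q : finGroupType) (G : AGroup) : AGroup.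
Proof.
apply: (@Build_AGroup ((Q -> G) * Q)%type
  (fun u v => (fun i => u.1 i ∙ v.1 (i * u.2)%g, (u.2 * v.2)%g))
  (fun=> gone G, 1%g)
  (fun u => (fun i => ginv (u.1 (i * u.2^-1)%g), u.2^-1%g))).
- move=> u v w /=; congr pair; last by rewrite mulgA.
  by apply/funext => i; rewrite gmulA mulgA.
- move=> [u q] /=; congr pair; last by rewrite mul1g.
  by apply/funext => i; rewrite gmul1 mulg1.
- move=> [u q] /=; congr pair; last by rewrite mulVg.
  by apply/funext => i; rewrite gmulV.
Defined.

Definition fin_agroup (Q : finGroupType) : AGroup :=
  @Build_AGroup Q (fun x y => x * y)%g 1%g (fun x => x^-1)%g (@mulgA Q) (@mul1g Q) (@mulVg Q).

(** * Reduced and cyclically reduced words *)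

Section Words.
Variables (A B : AGroup).
Definition letter := (A + B)%type.
Implicit Types (s r : letter) (l : seq letter).

Definition is_left s := if s is inl _ then true else false.
Definition nontriv s : bool :=
  match s with inl a => ~~ `[< a = gone A >] | inr b => ~~ `[< b = gone B >] end.
Definition letter_inv s : letter :=
  match s with inl a => inl (ginv a) | inr b => inr (ginv b) end.
Definition alternate s r := is_left s != is_left r.
Definition reduced l := all nontriv l && sorted alternate l.

Definition push s l := if nontriv s then s :: l else l.
(** Left multiplication by a letter, carried out on reduced words. *)
Definition act s l :=
  match s, l with
  | inl a, inl a' :: l' => push (inl (a ∙ a')) l'
  | inr b, inr b' :: l' => push (inr (b ∙ b')) l'
  | _, _ => push s l
  end.
Arguments act : simpl never.
Arguments push : simpl never.

Lemma reduced_cons s l :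
  reduced (s :: l) = [&& nontriv s, reduced l & (if l is r :: _ then alternate s r else true)].
Proof.
rewrite /reduced; case: l => [|r l] /=; case: (nontriv s) => //=.
by case: (alternate s r); rewrite ?andbF ?andbT.
Qed.

Lemma act_reduced_cons s l : reduced (s :: l) -> act s l = s :: l.
Proof.
rewrite reduced_cons /act /push => /and3P[]; case: s => s -> _; by case: l => // -[].
Qed.

Lemma push_reduced s l : reduced l -> (if l is r :: _ then alternate s r else true) ->
  reduced (push s l).
Proof. by rewrite /push => rl hl; case: ifP => // h; rewrite reduced_cons h rl. Qed.

Lemma act_reduced s l : reduced l -> reduced (act s l).
Proof.
case: l => [|r l]; first by case: s => s _; apply: push_reduced.
move=> rrl; move: (rrl); rewrite reduced_cons => /and3P[nr rl hl].
by case: s r rrl nr hl => s [] r rrl nr hl; apply: push_reduced => //;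
  case: l hl {rrl rl} => // -[].
Qed.

Lemma act_one l : reduced l -> act (inl (gone A)) l = l /\ act (inr (gone B)) l = l.
Proof.
case: l => [|r l]; first by rewrite /act /push /=; split; case: asboolP.
rewrite reduced_cons => /and3P[nr rl hl].
by case: r nr {hl} => r /= nr; rewrite /act /push /= !gmul1 nr (asboolT erefl).
Qed.

Lemma act_mulA (a a' : A) l : reduced l -> act (inl (a ∙ a')) l = act (inl a) (act (inl a') l).
Proof.
case: l => [|[r|r] l].
- rewrite /act /push /= => _.
  by case: (asboolP (a' = _)) => [->|_] /=; rewrite ?gmul1r.
- rewrite reduced_cons => /and3P[nr rl hl]; rewrite /act /push /= -gmulA.
  (* When a' cancels r, the rest of the word does not begin with a letter of A, so [a] is simply
     pushed onto it. *)
  case: (asboolP (a' ∙ r = _)) => [->|_] //=; rewrite gmul1r.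
  by case: l hl rl => // -[].
- move=> _; rewrite /act /push /=.
  by case: (asboolP (a' = _)) => [->|_] /=; rewrite ?gmul1r.
Qed.

Lemma act_mulB (b b' : B) l : reduced l -> act (inr (b ∙ b')) l = act (inr b) (act (inr b') l).
Proof.
case: l => [|[r|r] l].
- rewrite /act /push /= => _.
  by case: (asboolP (b' = _)) => [->|_] /=; rewrite ?gmul1r.
- move=> _; rewrite /act /push /=.
  by case: (asboolP (b' = _)) => [->|_] /=; rewrite ?gmul1r.
- rewrite reduced_cons => /and3P[nr rl hl]; rewrite /act /push /= -gmulA.
  case: (asboolP (b' ∙ r = _)) => [->|_] //=; rewrite gmul1r.
  by case: l hl rl => // -[].
Qed.

Lemma letter_invK : involutive letter_inv.
Proof. by case=> s /=; rewrite ginvK. Qed.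

Lemma nontriv_inv s : nontriv (letter_inv s) = nontriv s.
Proof.
by case: s => s /=; congr (~~ _); apply/asboolP/asboolP => [/ginv_eq1//|->]; rewrite ginv1.
Qed.

Lemma is_left_inv s : is_left (letter_inv s) = is_left s.
Proof. by case: s. Qed.

Lemma alternate_sym s r : alternate s r = alternate r s.
Proof. by rewrite /alternate eq_sym. Qed.

Lemma reduced_inv l : reduced l -> reduced (rev (map letter_inv l)).
Proof.
move=> /andP[nl sl]; apply/andP; split.
  by rewrite all_rev all_map; apply: sub_all nl => s /=; rewrite nontriv_inv.
rewrite rev_sorted sorted_map; apply: sub_sorted sl => s r /=.
by rewrite /alternate !is_left_inv eq_sym.
Qed.

Definition cyclically_reduced l := all nontriv l && path.cycle alternate l.

Lemma cyclically_reduced_pow l n :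
  cyclically_reduced l -> reduced (flatten (nseq n l)).
Proof.
case: l => [|s l]; first by move=> _; elim: n.
move=> /andP[nl /= cl]; apply/andP; split.
  by elim: n => //= n IH; rewrite all_cat IH andbT.
suff h r : alternate r s -> path alternate r (flatten (nseq n (s :: l))).
  (* The starting letter only has to lie in the other factor; its being trivial does no harm, since
     [path] tests alternation alone. *)
  apply: (path_sorted (h (if is_left s then inr (gone B) else inl (gone A)) _)).
  by case: (s).
move: cl; rewrite rcons_path => /andP[pl ll].
elim: n r => //= n IH r rs; rewrite rs /= cat_path pl /=; exact: IH.
Qed.

(** Prepares one step of cyclic reduction: both end letters are stripped, and the letter s' will be
    the product of the two. *)
Lemma reduced_trim s l r : reduced (s :: rcons l r) -> reduced l /\
  (is_left s = is_left r -> l <> [::]) /\ (forall s', nontriv s' -> is_left s' = is_left s ->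
    reduced (s' :: l)).
Proof.
rewrite /reduced /= all_rcons rcons_path => /andP[/and3P[ns nr nl] /andP[pl lr]].
rewrite nl (path_sorted pl) /=; split=> //; split.
  by move=> e le; move: lr; rewrite le /alternate /= e eqxx.
by move=> s' -> e /=; case: l pl {nl lr} => //= q l; rewrite /alternate e.
Qed.

End Words.

Arguments act {A B} s l : simpl never.

(** * Normal forms in a free product *)

Section NormalForm.
Variables (A B G : AGroup) (iA : A -> G) (iB : B -> G).
Hypothesis fp : is_free_product iA iB.
Let letter := (letter A B).

Definition emb (s : letter) : G := match s with inl a => iA a | inr b => iB b end.
Fixpoint ev (l : seq letter) : G := if l is s :: l' then emb s ∙ ev l' else gone G.

Let iAM : is_hom iA. Proof. by case: fp. Qed.
Let iBM : is_hom iB. Proof. by case: fp => _ []. Qed.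

Lemma ev_cat l l' : ev (l ++ l') = ev l ∙ ev l'.
Proof. by elim: l => [|s l IH] /=; rewrite ?gmul1 // IH gmulA. Qed.

Lemma ev_nseq n l : ev (flatten (nseq n l)) = gpow (ev l) n.
Proof. by elim: n => //= n IH; rewrite ev_cat IH. Qed.

Lemma emb_inv s : emb (letter_inv s) = ginv (emb s).
Proof. by case: s => s /=; apply: homV. Qed.

Lemma ev_inv l : ev (rev (map (@letter_inv A B) l)) = ginv (ev l).
Proof.
elim: l => [|s l IH] /=; first by rewrite ginv1.
by rewrite rev_cons -cats1 ev_cat IH /= gmul1r emb_inv ginvM.
Qed.

Lemma emb_triv s : ~~ nontriv s -> emb s = gone G.
Proof. by case: s => s /=; rewrite negbK => /asboolP ->; apply: hom1. Qed.

Lemma ev_push s l : ev (push s l) = emb s ∙ ev l.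
Proof. by rewrite /push; case: ifPn => // /emb_triv ->; rewrite gmul1. Qed.

Lemma ev_act s l : ev (act s l) = emb s ∙ ev l.
Proof.
case: s l => s [|[r|r] l]; rewrite /act ev_push //= gmulA.
- by rewrite iAM.
- by rewrite iBM.
Qed.

(* van der Waerden's trick: G acts by permutations on the set of reduced words. *)
Lemma normal_form_exists : exists nf : G -> seq letter,
  [/\ forall x, reduced (nf x), nf (gone G) = [::] &
      forall s x, nf (emb s ∙ x) = act s (nf x)].
Proof.
pose X := {l : seq letter | reduced l}.
pose pact s (l : X) : X := exist _ (act s (sval l)) (act_reduced s (svalP l)).
have pactK s : cancel (pact s) (pact (letter_inv s)).
  move=> [l rl]; apply: eq_exist => /=.
  case: s => s /=; rewrite -?act_mulA -?act_mulB // gmulV; by case: (act_one rl).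
have pactK' s : cancel (pact (letter_inv s)) (pact s).
  by move=> l; rewrite -{1}(letter_invK s) pactK.
pose rho s : perm_agroup X := Permutation (pactK s) (pactK' s).
have rA : is_hom (fun a => rho (inl a)).
  by move=> a a'; apply: permutation_ext => -[l rl]; apply: eq_exist; apply: act_mulA.
have rB : is_hom (fun b => rho (inr b)).
  by move=> b b'; apply: permutation_ext => -[l rl]; apply: eq_exist; apply: act_mulB.
have [[f [fM [fA fB]]] _] := fp.2.2 _ _ _ rA rB.
pose e : X := exist (fun l => is_true (reduced l)) [::] isT.
(* The normal form of x is the image of the empty word under the action of x. *)
exists (fun x => sval (pm (f x) e)); split.
- by move=> x; exact: (svalP (pm (f x) e)).
- by rewrite (hom1 fM).
- by move=> s x; rewrite fM /=; case: s => s /=; rewrite ?fA ?fB.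
Qed.

Variable nf : G -> seq letter.
Hypotheses (nf_red : forall x, reduced (nf x)) (nf1 : nf (gone G) = [::])
  (nf_act : forall s x, nf (emb s ∙ x) = act s (nf x)).

Lemma nf_ev l : reduced l -> nf (ev l) = l.
Proof.
elim: l => //= s l IH rl; rewrite nf_act IH ?act_reduced_cons //.
by move: rl; rewrite reduced_cons => /and3P[].
Qed.

Lemma ev_nf x : ev (nf x) = x.
Proof.
(* Quantified over y, the property of x defines a subgroup, so it need only be checked on the
   factors. *)
suff h y : ev (nf (x ∙ y)) = x ∙ ev (nf y) by rewrite -{1}(gmul1r x) h nf1 gmul1r.
elim/(free_product_ind fp): x y.
- split; first by move=> y; rewrite !gmul1.
  split=> [x x' hx hx' y|x hx y]; first by rewrite -!gmulA hx hx'.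
  by rewrite -{2}(gmulK x y) hx gmulKV.
- by move=> a y; rewrite (nf_act (inl a)) ev_act.
- by move=> b y; rewrite (nf_act (inr b)) ev_act.
Qed.

Lemma nf_inv x : nf (ginv x) = rev (map (@letter_inv A B) (nf x)).
Proof. by rewrite -{1}(ev_nf x) -ev_inv nf_ev // reduced_inv. Qed.

(** * Counting letters in the normal forms of powers *)

Lemma count_push (P : pred letter) s l : count P (push s l) <= (count P l).+1.
Proof. by rewrite /push; case: ifP => //= _; case: (P s). Qed.

Lemma count_act (P : pred letter) s l : count P (act s l) <= (count P l).+1.
Proof.
case: s l => s [|[r|r] l]; rewrite /act; apply: (leq_trans (count_push _ _ _)) => //=;
by rewrite ltnS leq_addl.
Qed.

Lemma count_mull (P : pred letter) s x :
  count P (nf (emb s ∙ x)) <= (count P (nf x)).+1.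
Proof. by rewrite nf_act count_act. Qed.

Lemma count_mulr (P : pred letter) s x :
  count P (nf (x ∙ emb s)) <= (count P (nf x)).+1.
Proof.
(* Inversion turns right multiplication into left multiplication, at the cost of changing the
   predicate. *)
have inv_count y : count P (nf y) = count (P \o @letter_inv A B) (nf (ginv y)).
  rewrite nf_inv count_rev count_map; apply: eq_count => r /=; by rewrite letter_invK.
rewrite !inv_count ginvM -emb_inv; exact: count_mull.
Qed.

Lemma count_conj (P : pred letter) s x :
  count P (nf (emb s ∙ x ∙ ginv (emb s))) <= (count P (nf x)).+2.
Proof.
by rewrite -emb_inv; apply: leq_trans (count_mulr _ _ _) _; rewrite ltnS count_mull.
Qed.

(** The count for x^n is nc up to a bounded error; allowing the error makes the rate c invariant
    under conjugation. *)
Definition growth (P : pred letter) (x : G) (c : nat) :=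
  exists D, forall n, count P (nf (gpow x n)) <= n * c + D /\
                      n * c <= count P (nf (gpow x n)) + D.

Lemma growth_conj (P : pred letter) s x c :
  growth P (emb s ∙ x ∙ ginv (emb s)) c -> growth P x c.
Proof.
case=> D hD; exists (D + 2) => n; have [] := hD n; rewrite gpow_conj => h1 h2.
have := count_conj P s (gpow x n).
(* Conjugating back gives the reverse inequality. *)
have := count_conj P (letter_inv s) (emb s ∙ gpow x n ∙ ginv (emb s)).
by rewrite emb_inv ginvK -!gmulA gmulV gmul1r gmulKV !gmulA; lia.
Qed.

(** Concatenated copies of the word are already in normal form, so the error is 0. *)
Lemma growth_cyclically_reduced (P : pred letter) l :
  cyclically_reduced l -> growth P (ev l) (count P l).
Proof.
move=> cl; exists 0 => n; rewrite -ev_nseq nf_ev ?cyclically_reduced_pow // !addn0.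
suff -> : count P (flatten (nseq n l)) = n * count P l by [].
by elim: n => //= n IH; rewrite count_cat IH mulSn.
Qed.

Lemma growth_letter (P : pred letter) s : growth P (emb s) 0.
Proof.
exists 1 => n; rewrite muln0; split=> //.
have [r ->] : exists r, gpow (emb s) n = emb r ∙ gone G.
  case: s => s; [exists (inl (gpow s n)) | exists (inr (gpow s n))];
  by rewrite gmul1r /= homX.
by apply: leq_trans (count_mull _ _ _) _; rewrite nf1.
Qed.

(* The growth rate is an integer: it is the number of occurrences of P in the
   cyclic reduction of x. *)
Lemma growth_exists (P : pred letter) x : exists c, growth P x c.
Proof.
rewrite -(ev_nf x); move: (nf x) (nf_red x) => l.
have [m] := ubnP (size l); elim: m l => // m IH [|s l] lm rl.
  by exists 0, 0 => n /=; rewrite gpow1n nf1 muln0.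
case/lastP: l => [|l r] in lm rl *.
  by exists 0; rewrite /= gmul1r; apply: growth_letter.
have [sr|sr] := boolP (is_left s == is_left r); last first.
  exists (count P (s :: rcons l r)); apply: growth_cyclically_reduced.
  case/andP: rl => nl pl; rewrite /cyclically_reduced nl /= rcons_path.
  by move: pl => /= ->; rewrite last_rcons /= alternate_sym.
have [rl' [ln0 rs]] := reduced_trim rl; rewrite /= size_rcons in lm.
suff [c hc] : exists c, growth P (emb r ∙ ev (s :: rcons l r) ∙ ginv (emb r)) c.
  by exists c; apply: growth_conj hc.
(* When the ends lie in one factor, conjugation by the last letter merges them into a single letter
   q. The word gets shorter by one letter, or by two if q is trivial. *)
have -> : emb r ∙ ev (s :: rcons l r) ∙ ginv (emb r) = (emb r ∙ emb s) ∙ ev l.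
  by rewrite /= -cats1 ev_cat /= gmul1r -!gmulA gmulVr gmul1r.
have [q [qE ql]] : exists q, emb r ∙ emb s = emb q /\ is_left q = is_left s.
  case: s r sr {lm rl ln0 rs} => s [] r // _; [exists (inl (r ∙ s)) | exists (inr (r ∙ s))];
  by rewrite /= ?iAM ?iBM.
rewrite qE; have [nq|nq] := boolP (nontriv q).
  by apply: (IH (q :: l)); [rewrite /=; lia | apply: rs].
by rewrite (emb_triv nq) gmul1; apply: IH => //; lia.
Qed.

Lemma growth_pow (P : pred letter) x c n : growth P x c -> growth P (gpow x n) (n * c).
Proof.
by case=> D hD; exists D => m; rewrite -gpowM mulnA (mulnC m); apply: hD.
Qed.

Lemma growth_unique (P : pred letter) x c c' : growth P x c -> growth P x c' -> c = c'.
Proof.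
case=> D hD [D' hD']; have [] := hD (D + D').+1; have [] := hD' (D + D').+1.
by move: (count _ _); nia.
Qed.

End NormalForm.

Lemma is_free_product_sym (A B G : AGroup) (iA : A -> G) (iB : B -> G) :
  is_free_product iA iB -> is_free_product iB iA.
Proof.
case=> hA [hB up]; split=> //; split=> // H fB fA fBM fAM.
have [[f [fM [e1 e2]]] uniq] := up H fA fB fAM fBM; split; first by exists f.
by move=> g g' gM g'M eB eA; apply: uniq.
Qed.

(** * Alternating words and roots of their powers *)

Section AlternatingWord.
Variables (A B : AGroup) (b : B).
Implicit Type s : seq A.

Definition alternating_word s : seq (letter A B) :=
  flatten [seq [:: inl a; inr b] | a <- s].

Lemma alternating_word_cyclically_reduced s :
  b <> gone B -> (forall a, In a s -> a <> gone A) ->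
  cyclically_reduced (alternating_word s).
Proof.
move=> b1 s1; apply/andP; split.
  elim: s s1 => //= a s IH s1; rewrite !asboolF ?IH //=; last by apply: s1; left.
  by move=> a' a's; apply: s1; right.
(* With the default [inr b] this covers the empty word too; the cycle becomes a path starting at
   [inr b]. *)
have lst : last (inr b) (alternating_word s) = inr b by elim: s {s1}.
by rewrite (cycle_path (inr b)) lst; elim: s {s1 lst}.
Qed.

Lemma count_alternating_word (P : pred (letter A B)) s : ~~ P (inr b) ->
  count P (alternating_word s) = count (P \o inl) s.
Proof. by move=> /negbTE nP; elim: s => //= a s ->; rewrite nP. Qed.

End AlternatingWord.

(* The syllable t^(p+1) occurs exactly once in the cyclically reduced word h,
   while in a p-th power every syllable occurs a multiple of p times. *)
Lemma root_exponent_dvd (A B G : AGroup) (iA : A -> G) (iB : B -> G) (t : A) (b : B)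
    (p k N : nat) (u : G) :
  is_free_product iA iB -> unique_root A -> t <> gone A -> b <> gone B ->
  1 < p -> 0 < N ->
  let h := iA (ginv (gpow t p) ∙ t) ∙ iB b ∙ gpow (iA t ∙ iB b) (p - 2)
             ∙ (iA (t ∙ gpow t p) ∙ iB b) in
  gpow u (p * N) = gpow h (k * N) -> p %| k.
Proof.
move=> fp ur t1 b1 p1 N0 h uh.
have tf n : 0 < n -> gpow t n <> gone A by move=> n0 /(torsion_free ur n0).
have [nf [nf_red nf1 nf_act]] := normal_form_exists fp.
(* The A-letters of h: t^(1-p), then p-2 copies of t, then t^(p+1). Torsion-freeness makes them
   nontrivial and keeps the last one distinct from the others. *)
pose s := (ginv (gpow t p) ∙ t) :: nseq (p - 2) t ++ [:: t ∙ gpow t p].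
pose P (r : letter A B) := if r is inl a then `[< a = t ∙ gpow t p >] else false.
have hE : h = ev iA iB (alternating_word b s).
  rewrite /h /s /alternating_word /= map_cat flatten_cat ev_cat /= gmul1r.
  rewrite map_nseq ev_nseq /= gmul1r -!gmulA //.
have tt : t <> t ∙ gpow t p.
  by rewrite -{1}(gmul1r t) => /gmulI /esym /tf; apply; lia.
have ttV : ginv (gpow t p) ∙ t <> t ∙ gpow t p.
  move=> /(f_equal (gmul (gpow t p))); rewrite gmulK.
  rewrite -[_ ∙ (t ∙ _)]/(gpow t p ∙ gpow t p.+1) -gpowD.
  by rewrite addnS /= -{1}(gmul1r t) => /gmulI /esym /tf; apply; lia.
have s1 a : In a s -> a <> gone A.
  case=> [<-|].
    move=> /(f_equal (gmul (gpow t p))); rewrite gmulK gmul1r -(ltn_predK p1) /=.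
    by rewrite -{1}(gmul1r t) => /gmulI /esym /tf; apply; lia.
  move=> /in_app_iff[|[<-|[]]]; last by apply: (tf p.+1).
  by elim: (p - 2) => //= n IH [<-|].
have cs : count (P \o inl) s = 1.
  rewrite /s /= count_cat count_nseq /= !(asboolF ttV, asboolF tt) asboolT //.
have gh : growth nf P h 1.
  rewrite hE -cs -(count_alternating_word (b := b)) //.
  apply: growth_cyclically_reduced => //.
  exact: alternating_word_cyclically_reduced.
have [c gu] := growth_exists fp nf_red nf1 nf_act P u.
(* Comparing rates gives pNc = kN, and N cancels. *)
have := growth_pow (p * N) gu; rewrite uh => /growth_unique /(_ (growth_pow (k * N) gh)).
rewrite muln1 mulnAC => /eqP; rewrite eqn_pmul2r // => /eqP <-; exact: dvdn_mulr.
Qed.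

(** * Partial conjugations on the kernel of a finite quotient *)

Section Twist.
Variables (A B G : AGroup) (iA : A -> G) (iB : B -> G).
Hypothesis fp : is_free_product iA iB.
Variables (Q : finGroupType) (F : G -> Q).
Hypotheses (FM : forall x y, F (x ∙ y) = (F x * F y)%g) (FB : forall b, F (iB b) = 1%g).

Let iAM : is_hom iA. Proof. by case: fp. Qed.
Let iBM : is_hom iB. Proof. by case: fp => _ []. Qed.

Let F1 : F (gone G) = 1%g. Proof. exact: (@hom1 G (fin_agroup Q) F FM). Qed.
Let FV x : F (ginv x) = (F x)^-1%g. Proof. exact: (@homV G (fin_agroup Q) F FM). Qed.

(* A cocycle amounts to a homomorphism from G to the wreath product of G by Q lying over F;
   on the kernel of F each theta i is a homomorphism. *)
Definition cocycle (theta : Q -> G -> G) :=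
  forall i x y, theta i (x ∙ y) = theta i x ∙ theta (i * F x)%g y.

Lemma cocycle1 theta i : cocycle theta -> theta i (gone G) = gone G.
Proof. by move=> h; apply: gidem; rewrite -{3}(gmul1 (gone G)) h F1 mulg1. Qed.

Lemma cocycleV theta i x : cocycle theta ->
  theta i (ginv x) = ginv (theta (i * (F x)^-1)%g x).
Proof.
move=> h; rewrite -(ginvK (theta i _)); congr ginv; apply/esym/ginv_unique.
by rewrite -FV -h gmulV cocycle1.
Qed.

Lemma cocycle_ext theta eta : cocycle theta -> cocycle eta ->
  (forall i a, theta i (iA a) = eta i (iA a)) ->
  (forall i b, theta i (iB b) = eta i (iB b)) ->
  forall i x, theta i x = eta i x.
Proof.
move=> ht he eA eB i x; elim/(free_product_ind fp): x i => //.
split; first by move=> i; rewrite !cocycle1.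
split=> [x y hx hy i|x hx i]; first by rewrite ht he hx hy.
by rewrite !cocycleV ?hx.
Qed.

(** The index records the image under F of the prefix read so far. Thus [theta 1] conjugates a
    letter of B exactly when the prefix before it lies in the kernel: it twists the factor B and
    fixes its conjugates by the other coset representatives. *)
Definition partial_conj (x : G) (theta : Q -> G -> G) :=
  [/\ cocycle theta, forall i a, theta i (iA a) = iA a &
      forall i b, theta i (iB b) = if i == 1%g then x ∙ iB b ∙ ginv x else iB b].

Lemma partial_conj_exists x : exists theta, partial_conj x theta.
Proof.
pose fA a : wreath_agroup Q G := (fun=> iA a, F (iA a)).
pose fB b : wreath_agroup Q G :=
  (fun i => if i == 1%g then x ∙ iB b ∙ ginv x else iB b, 1%g).
have fAM : is_hom fA.
  by move=> a a'; congr pair; [apply/funext => i; exact: iAM | rewrite iAM FM].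
have fBM : is_hom fB.
  move=> b b'; congr pair; last by rewrite /= mulg1.
  apply/funext => i; rewrite /= mulg1 iBM; case: ifP => // _.
  by rewrite -!gmulA gmulKV.
have [[f [fM [fA' fB']]] _] := fp.2.2 _ _ _ fAM fBM.
(* Uniqueness identifies the second component with F, which makes the first one a cocycle. *)
have f2 y : (f y).2 = F y.
  have hA : @is_hom A (fin_agroup Q) (F \o iA) by move=> a a' /=; rewrite iAM FM.
  have hB : @is_hom B (fin_agroup Q) (F \o iB) by move=> a a' /=; rewrite iBM FM.
  have [_ uniq] := fp.2.2 _ _ _ hA hB.
  apply: (uniq (fun y => (f y).2) F) => //.
  - by move=> z z'; rewrite fM.
  - by move=> a; rewrite fA'.
  - by move=> b; rewrite fB' /= FB.
exists (fun i y => (f y).1 i); split.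
- by move=> i y z; rewrite fM /= f2.
- by move=> i a; rewrite fA'.
- by move=> i b; rewrite fB'.
Qed.

(** Letters of B change only to conjugates, and F kills both. Hence the kernel is preserved, and
    composites are again cocycles. *)
Lemma partial_conj_F x theta i y : partial_conj x theta -> F (theta i y) = F y.
Proof.
case=> ht hA hB; elim/(free_product_ind fp): y i.
- split; first by move=> i; rewrite cocycle1.
  split=> [y z hy hz i|y hy i]; first by rewrite ht !FM hy hz.
  by rewrite cocycleV // !FV hy.
- by move=> a i; rewrite hA.
- by move=> b i; rewrite hB; case: ifP => // _; rewrite !FM FV FB mulg1 mulgV.
Qed.

Lemma partial_conjK (a : A) theta eta : F (iA a) = 1%g ->
  partial_conj (iA a) theta -> partial_conj (ginv (iA a)) eta ->
  forall i y, eta i (theta i y) = y.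
Proof.
move=> Fa pt pe; have [ht tA tB] := pt; have [he eA eB] := pe.
apply: (@cocycle_ext (fun i y => eta i (theta i y)) (fun _ y => y)) => //.
- by move=> i y z; rewrite ht he (partial_conj_F _ _ pt).
- by move=> i a'; rewrite tA eA.
- move=> i b; rewrite tB; case: (eqVneq i 1%g) => [->|ne]; last by rewrite eB (negbTE ne).
  (* As F is trivial on the conjugator, the inner letter of B is again read at index 1, where [eta]
     undoes the conjugation. *)
  rewrite !he FM Fa FB !mulg1 cocycleV // Fa invg1 mulg1 eA eB eqxx.
  by rewrite ginvK -!gmulA gmulVr gmul1r gmulK.
Qed.

Lemma kernel_finite_index : (forall q, exists x, F x = q) -> finite_index (fun x => F x = 1%g).
Proof.
move=> /choice[r hr]; split.
  by split=> //; split=> [x y hx hy|x hx]; rewrite ?FM ?FV ?hx ?hy ?mulg1 ?invg1.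
exists (map r (enum Q)) => x; exists (r (F x)); split; last by rewrite FM FV hr mulVg.
apply: in_map; have : F x \in enum Q by rewrite mem_enum.
by elim: (enum Q) => //= q e IH; rewrite inE => /orP[/eqP->|/IH]; [left|right].
Qed.

Lemma partial_conj_is_comm (a : A) theta : F (iA a) = 1%g ->
  (forall q, exists x, F x = q) -> partial_conj (iA a) theta ->
  is_comm (PMap (fun x => F x = 1%g) (fun x => F x = 1%g) (theta 1%g)).
Proof.
move=> Fa Fsurj pt; have [eta pe] := partial_conj_exists (ginv (iA a)).
have fi := kernel_finite_index Fsurj; have [ht _ _] := pt.
have tK := partial_conjK Fa pt pe.
have eK i y : theta i (eta i y) = y.
  have := @partial_conjK (ginv a) eta theta.
  by rewrite (homV iAM) ginvK FV Fa invg1 => /(_ erefl pe pt).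
split=> //; split=> //=; split; first by move=> x; rewrite (partial_conj_F _ _ pt).
split; first by move=> x y hx hy; rewrite ht hx mulg1.
split; first by move=> x y _ _ e; rewrite -(tK 1%g x) e tK.
by move=> y hy; exists (eta 1%g y); rewrite eK (partial_conj_F _ _ pe).
Qed.

(* Going once around the cosets 1, t, ..., t^(p-1), only the last factor b meets the twist. *)
Lemma partial_conj_pow (x : G) theta (t : A) (b : B) n :
  partial_conj x theta -> #[F (iA t)]%g = n.+1 ->
  theta 1%g (gpow (iA t ∙ iB b) n.+1) =
    gpow (iA t ∙ iB b) n ∙ (iA t ∙ (x ∙ iB b ∙ ginv x)).
Proof.
move=> [ht hA hB] ord; set q := F (iA t).
have step i y : theta i (iA t ∙ iB b ∙ y) =
    iA t ∙ theta (i * q)%g (iB b) ∙ theta (i * q)%g y.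
  by rewrite !ht hA FM FB mulg1.
(* The last m+1 factors are read from index q^(n-m); their letters b then meet the indices
   q^(n-m+1), ..., q^(n+1) = 1. *)
suff h m : m <= n -> theta (q ^+ (n - m))%g (gpow (iA t ∙ iB b) m.+1) =
    gpow (iA t ∙ iB b) m ∙ (iA t ∙ (x ∙ iB b ∙ ginv x)).
  by have := h n (leqnn n); rewrite subnn expg0.
elim: m => [_|m IH mn].
  by rewrite [gpow _ 1]/= step cocycle1 // hB subn0 -expgSr -ord expg_order eqxx gmul1r gmul1.
have e : (q ^+ (n - m.+1) * q = q ^+ (n - m))%g by rewrite -expgSr; congr (_ ^+ _)%g; lia.
rewrite [gpow _ m.+2]/= step e IH ?(ltnW mn) // hB ifF; first by rewrite /= -!gmulA.
by apply/negbTE; rewrite -order_dvdn ord gtnNdvd //; lia.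
Qed.

End Twist.

(** * Commensurations whose domains contain powers prime to p *)

Lemma is_comm_pow (G : AGroup) (c : pmap G) x n : is_comm c -> pdom c x ->
  pdom c (gpow x n) /\ pfun c (gpow x n) = gpow (pfun c x) n.
Proof.
move=> [[[c1 [cM _]] _] [_ [_ [chom _]]]] cx.
have e1 : pfun c (gone G) = gone G by apply: gidem; rewrite -chom // gmul1.
elim: n => [//|n [hd hf]].
by split=> /=; [apply: cM | rewrite chom // hf].
Qed.

Section SmallIndex.
Variables (G : AGroup) (p : nat).
Hypothesis p_pr : prime p.

(** Indices of domains may grow under composition, whereas exponents prime to p merely multiply and
    stay prime to p. *)
Definition p_small (c : pmap G) :=
  [/\ forall x, pdom c x -> pcod c (pfun c x),
      forall x n, pdom c x -> pdom c (gpow x n) /\ pfun c (gpow x n) = gpow (pfun c x) n &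
      forall y, exists k, ~~ (p %| k) /\ pdom c (gpow y k)].

Lemma comm_gen_small (S : seq (pmap G)) :
  (forall s, In s S -> is_comm s) ->
  (forall s, In s S -> forall y, exists k, ~~ (p %| k) /\ pdom s (gpow y k)) ->
  (forall s, In s S -> forall y, exists k, ~~ (p %| k) /\ pcod s (gpow y k)) ->
  forall d, comm_gen S d -> p_small d.
Proof.
move=> Sc Sd Sr d; elim => {d} [|s sS|s d sS [dd [dr dV]]|a b _ [a1 a2 a3] _ [b1 b2 b3]].
- by split=> // y; exists 1; rewrite dvdn1; split=> //; case: eqP p_pr => // ->.
- have [_ [_ [scod _]]] := Sc _ sS.
  by split; [exact: scod | move=> x n; apply: is_comm_pow; apply: Sc | exact: Sd].
- have [_ [_ [scod [_ [_ ssurj]]]]] := Sc _ sS.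
  split.
  + by move=> x /dd /ssurj[x' [sx' <-]]; apply/dr; rewrite dV.
  + move=> x n /dd /ssurj[x' [sx' <-]]; have [h1 h2] := is_comm_pow n (Sc _ sS) sx'.
    by rewrite dV // -h2 dV //; split=> //; apply/dd/scod.
  (* The domain of an inverse is the range of a generator, which is why ranges are controlled as
     well. *)
  + by move=> y; have [k [pk hk]] := Sr _ sS y; exists k; split=> //; apply/dd.
- split=> /=.
  + by move=> x [ax [ar bx]]; exists (pfun a x).
  + move=> x n [ax [ar bx]]; have [h1 h2] := a2 x n ax; have [h3 h4] := b2 _ n bx.
    by split; [split=> //; split; [exact: a1 | rewrite h2] | rewrite h2 h4].
  + move=> y; have [k [pk hk]] := a3 y; have [l [pl hl]] := b3 (pfun a (gpow y k)).
    exists (k * l); rewrite Euclid_dvdM // negb_or pk pl gpowM; split=> //.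
    have [h1 h2] := a2 _ l hk; split=> //; split; [exact: a1 | by rewrite h2].
Qed.

End SmallIndex.

(** The sum of the pigeonhole bounds for all domains and ranges serves as m: a larger p cannot
    divide a positive exponent below it. *)
Lemma index_bound (G : AGroup) (S : seq (pmap G)) : (forall s, In s S -> is_comm s) ->
  exists m, forall p, m < p -> forall s, In s S ->
    (forall y, exists k, ~~ (p %| k) /\ pdom s (gpow y k)) /\
    (forall y, exists k, ~~ (p %| k) /\ pcod s (gpow y k)).
Proof.
elim: S => [|s S IH] Sc; first by exists 0.
have [m hm] := IH (fun r rS => Sc r (or_intror rS)).
have [/finite_index_pow[m1 h1] [/finite_index_pow[m2 h2] _]] := Sc s (or_introl erefl).
exists (m + m1 + m2) => p mp r [<-|rS]; last by apply: hm => //; lia.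
split=> y.
- by have [k [k0 km hk]] := h1 y; exists k; split=> //; rewrite gtnNdvd //; lia.
- by have [k [k0 km hk]] := h2 y; exists k; split=> //; rewrite gtnNdvd //; lia.
Qed.

(** * The twist lies outside every finitely generated subgroup *)

Lemma not_comm_fin_gen_left (A B G : AGroup) (iA : A -> G) (iB : B -> G) :
  is_free_product iA iB -> nontrivial B -> unique_root A ->
  arb_large_prime_quotients A -> ~ comm_fin_gen G.
Proof.
move=> fp [b b1] urA large [S [Sc Sgen]].
have [m hm] := index_bound Sc.
have [p [p_pr [mp [Q [f [cQ [fM fsurj]]]]]]] := large m.
have fM' : @is_hom A (fin_agroup Q) f by [].
have f1 : @is_hom B (fin_agroup Q) (fun=> 1%g) by move=> x y /=; rewrite mulg1.
have [[F [FM [FA FB]]] _] := fp.2.2 _ _ _ fM' f1.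
have p1 := prime_gt1 p_pr.
have [q q1] : exists q : Q, q != 1%g.
  apply: contrapT => h; suff : #|Q| <= 1 by rewrite cQ; lia.
  have a1 (q : Q) : q = 1%g by apply/eqP; apply: contra_notT h => q1; exists q.
  by apply/fintype_le1P => x y; rewrite (a1 x) (a1 y).
have [t tq] := fsurj q.
have ordq : #[q]%g = p.
  have : #[q]%g %| p by rewrite -cQ -cardsT order_dvdG ?inE.
  case/primeP: (p_pr) => _ pd /pd /orP[|/eqP //].
  by rewrite order_eq1 (negbTE q1).
have t1 : t <> gone A by move=> e; move: q1; rewrite -tq e (hom1 fM') eqxx.
have Fx : F (iA (gpow t p)) = 1%g.
  rewrite FA (homX fM') tq -ordq -[RHS](expg_order q).
  by elim: #[q]%g => //= n ->; rewrite expgS.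
have Fsurj (r : Q) : exists x, F x = r by have [a <-] := fsurj r; exists (iA a).
have [theta pt] := partial_conj_exists fp FM FB (iA (gpow t p)).
have cc := partial_conj_is_comm fp FM FB Fx Fsurj pt.
have [d [dS [L [fiL agree]]]] := Sgen _ cc.
have [_ dX dk] := comm_gen_small p_pr Sc (fun s sS => (hm p mp s sS).1)
  (fun s sS => (hm p mp s sS).2) dS.
set g := iA t ∙ iB b; have [k [pk hk]] := dk g.
have [M hM] := finite_index_pow fiL.
have [N [N0 _ LN]] := hM (gpow g (k * p)).
have [_ [_ eq]] := agree _ LN; move: eq => /=.
(* One element of L is read in two ways: as a power of g^k, on which d is defined, and as a power of
   g^p, on which the twist is. *)
have -> : gpow (gpow g (k * p)) N = gpow (gpow g k) (p * N) by rewrite -!gpowM mulnA.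
rewrite (dX _ _ hk).2.
have -> : gpow (gpow g k) (p * N) = gpow (gpow g p) (k * N).
  by rewrite -!gpowM; congr gpow; lia.
have Fg : F (gpow g p) = 1%g.
  by rewrite (homX FM) /g FM FB /= mulg1 -(homX FM) -(homX fp.1).
have /= [_ ->] := is_comm_pow (k * N) cc Fg.
set u := pfun d _; set x := iA (gpow t p) in pt *.
have -> : theta 1%g (gpow g p) = x ∙ (iA (ginv (gpow t p) ∙ t) ∙ iB b ∙
    gpow (iA t ∙ iB b) (p - 2) ∙ (iA (t ∙ gpow t p) ∙ iB b)) ∙ ginv x.
  have [n pE] : exists n, p = n.+2 by exists (p - 2); lia.
  have ord : #[F (iA t)]%g = n.+2 by rewrite FA tq ordq.
  rewrite {1}pE (partial_conj_pow FM FB b pt ord).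
  have -> : p - 2 = n by rewrite pE subn2.
  by rewrite !fp.1 (homV fp.1) -/x /= -!gmulA gmulK.
move=> e; move/negP: pk; apply.
(* Conjugating u by the inverse of x = t^p removes the conjugation around h. *)
apply: (root_exponent_dvd fp urA t1 b1 p1 N0 (u := ginv x ∙ u ∙ ginv (ginv x))).
rewrite [LHS]gpow_conj -e gpow_conj ginvK.
by rewrite -!gmulA gmulV gmul1r gmulKV.
Qed.

Theorem theorem3p2 (A B G : AGroup) (iA : A -> G) (iB : B -> G) :
  is_free_product iA iB ->
  nontrivial A -> nontrivial B ->
  unique_root A -> unique_root B ->
  (arb_large_prime_quotients A \/ arb_large_prime_quotients B) ->
  ~ comm_fin_gen G.
Proof.
move=> fp nA nB urA urB [] large.
- exact: (not_comm_fin_gen_left fp).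
(* The free product is symmetric in its factors, so their roles are exchanged. *)
- exact: (not_comm_fin_gen_left (is_free_product_sym fp)).
Qed.
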